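(* Let $(N,\preceq,F)$ be a transitive-closed description of a simply dependent multimodal logic. Then the linear nested sequent calculus $\mathsf{LNS}_{(N,\preceq,F)}$ extended with contraction and weakening is sound and complete for $\mathcal{L}_{(N,\preceq,F)}$: for every formula $A$, $A\in\mathcal{L}_{(N,\preceq,F)}$ if and only if the linear nested sequent $\;\Rightarrow A$ (one component) is derivable in this calculus.
   Context: A description is a triple $(N,\preceq,F)$ with $N$ a finite set of natural numbers, $\preceq$ a partial order on $N$, and each $F(i)$ the extension of modal logic $\mathsf{K}$ by some subset of $\mathsf{D}: \neg\Box\bot$, $\mathsf{T}: \Box A\to A$, $\mathsf{4}: \Box A\to\Box\Box A$; $\mathsf{KAx}\subseteq F(i)$ means $F(i)$ proves all theorems of $\mathsf{K}+\mathsf{Ax}$. Formulas are built from propositional variables, $\bot,\top,\neg,\land,\lor,\to$ and $\Box_i$ ($i\in N$). $\mathcal{L}_{(N,\preceq,F)}$ is the smallest set of formulas containing the propositional tautologies, $\Box_i(A\to B)\to(\Box_iA\to\Box_iB)$ and the $\Box_i$-instances of the extra axioms of $F(i)$ for each $i$, and $\Box_jA\to\Box_iA$ whenever $i\preceq j$, closed under modus ponens and necessitation for each $\Box_i$. Transitive-closed: $i\preceq j$ and $\mathsf{K4}\subseteq F(i)$ imply $\mathsf{K4}\subseteq F(j)$. Standing assumption of the paper: for $i\preceq j$, $\mathsf{KD}\subseteq F(i)\Rightarrow\mathsf{KD}\subseteq F(j)$ and $\mathsf{KT}\subseteq F(i)\Rightarrow\mathsf{KT}\subseteq F(j)$. A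 linear nested sequent is a finite nonempty list $\Gamma_1\Rightarrow\Delta_1\,/_{i_1}\,\Gamma_2\Rightarrow\Delta_2\,/_{i_2}\cdots/_{i_{n-1}}\,\Gamma_n\Rightarrow\Delta_n$ of sequents (components; each $\Gamma_k,\Delta_k$ a finite multiset of formulas) separated by nesting operators $/_i$ with $i\in N$. $\mathcal{S}\{\Gamma\Rightarrow\Delta\}$ denotes a linear nested sequent with a distinguished component $\Gamma\Rightarrow\Delta$, and $\mathcal{G}\,/_k\,\Gamma\Rightarrow\Delta$ denotes one whose last component is $\Gamma\Rightarrow\Delta$ (the prefix $\mathcal{G}\,/_k$ may be empty). Propositional rules (applicable in any component, rest unchanged): zero-premiss rules $\mathcal{S}\{\Gamma,p\Rightarrow p,\Delta\}$ ($p$ atomic), $\mathcal{S}\{\Gamma,\bot\Rightarrow\Delta\}$, $\mathcal{S}\{\Gamma\Rightarrow\top,\Delta\}$; and the standard two-sided rules for $\neg,\lor,\land,\to$ inside $\mathcal{S}\{\cdot\}$: $\neg_L$ ($\mathcal{S}\{\Gamma\Rightarrow A,\Delta\}$ / $\mathcal{S}\{\Gamma,\neg A\Rightarrow\Delta\}$), $\neg_R$ ($\mathcal{S}\{\Gamma,A\Rightarrow\Delta\}$ / $\mathcal{S}\{\Gamma\Rightarrow\neg A,\Delta\}$), $\lor_L$ (premisses $\mathcal{S}\{\Gamma,A\Rightarrow\Delta\}$, $\mathcal{S}\{\Gamma,B\Rightarrow\Delta\}$), $\lor_R$ (premiss $\mathcal{S}\{\Gamma\Rightarrow A,B,\Delta\}$),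 $\land_L$ (premiss $\mathcal{S}\{\Gamma,A,B\Rightarrow\Delta\}$), $\land_R$ (premisses $\mathcal{S}\{\Gamma\Rightarrow A,\Delta\}$, $\mathcal{S}\{\Gamma\Rightarrow B,\Delta\}$), $\to_L$ (premisses $\mathcal{S}\{\Gamma,B\Rightarrow\Delta\}$, $\mathcal{S}\{\Gamma\Rightarrow A,\Delta\}$), $\to_R$ (premiss $\mathcal{S}\{\Gamma,A\Rightarrow B,\Delta\}$). Contraction and weakening: the usual left/right rules applied inside any component. Modal rules of $\mathsf{LNS}_{(N,\preceq,F)}$: $(\Box_{ij})_L$ for $j\preceq i$: from $\mathcal{S}\{\Gamma\Rightarrow\Delta\,/_j\,\Sigma,A\Rightarrow\Pi\}$ infer $\mathcal{S}\{\Gamma,\Box_iA\Rightarrow\Delta\,/_j\,\Sigma\Rightarrow\Pi\}$; $(\Box_i)_R$ for every $i$: from $\mathcal{G}/_k\Gamma\Rightarrow\Delta\,/_i\,\Rightarrow A$ infer $\mathcal{G}/_k\Gamma\Rightarrow\Delta,\Box_iA$; $\mathsf{d}_{ij}$ for $j\preceq i$ with $\mathsf{KD}\subseteq F(j)$: from $\mathcal{G}/_k\Gamma\Rightarrow\Delta\,/_j\,A\Rightarrow\;$ infer $\mathcal{G}/_k\Gamma,\Box_iA\Rightarrow\Delta$; $\mathsf{t}_i$ for $\mathsf{KT}\subseteq F(i)$: from $\mathcal{S}\{\Gamma,A\Rightarrow\Delta\}$ infer $\mathcal{S}\{\Gamma,\Box_iA\Rightarrow\Delta\}$; $\mathsf{4}_{ij}$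 for $j\preceq i$ with $\mathsf{K4}\subseteq F(i)$: from $\mathcal{S}\{\Gamma\Rightarrow\Delta\,/_j\,\Sigma,\Box_iA\Rightarrow\Pi\}$ infer $\mathcal{S}\{\Gamma,\Box_iA\Rightarrow\Delta\,/_j\,\Sigma\Rightarrow\Pi\}$. A derivation is a finite tree of rule applications whose leaves are zero-premiss rules. *)

(* Defs.v *)
(* MathComp, with finmap for finite sets of naturals and finite multisets. *)
From HB Require Import structures.
From mathcomp Require Import all_boot.
From mathcomp Require Import finmap multiset.

Set Implicit Arguments.
Unset Strict Implicit.
Unset Printing Implicit Defensive.

Local Open Scope mset_scope.

Inductive form (I : Type) : Type :=
  | Var of nat
  | Bot
  | Top
  | Neg of form I
  | And of form I & form I
  | Or of form I & form I
  | Imp of form I & form I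
  | Box of I & form I.

Arguments Var {I} _.
Arguments Bot {I}.
Arguments Top {I}.

(* Multisets of formulas require a [choiceType]; it is obtained by encoding
   formulas as generic trees. *)
Section FormChoice.
Variable I : choiceType.

Fixpoint form_encode (A : form I) : GenTree.tree (nat + I) :=
  match A with
  | Var p => GenTree.Leaf (inl p)
  | Bot => GenTree.Node 0 [::]
  | Top => GenTree.Node 1 [::]
  | Neg B => GenTree.Node 2 [:: form_encode B]
  | And B C => GenTree.Node 3 [:: form_encode B; form_encode C]
  | Or B C => GenTree.Node 4 [:: form_encode B; form_encode C]
  | Imp B C => GenTree.Node 5 [:: form_encode B; form_encode C]
  | Box i B => GenTree.Node 6 [:: GenTree.Leaf (inr i); form_encode B]
  end.

Fixpoint form_decode (t : GenTree.tree (nat + I)) : form I :=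
  match t with
  | GenTree.Leaf (inl p) => Var p
  | GenTree.Node 1 [::] => Top
  | GenTree.Node 2 [:: t1] => Neg (form_decode t1)
  | GenTree.Node 3 [:: t1; t2] => And (form_decode t1) (form_decode t2)
  | GenTree.Node 4 [:: t1; t2] => Or (form_decode t1) (form_decode t2)
  | GenTree.Node 5 [:: t1; t2] => Imp (form_decode t1) (form_decode t2)
  | GenTree.Node 6 [:: GenTree.Leaf (inr i); t1] => Box i (form_decode t1)
  | _ => Bot
  end.

Lemma form_encodeK : cancel form_encode form_decode.
Proof.
by elim=> //= [A ->|A -> B ->|A -> B ->|A -> B ->|i A ->].
Qed.

HB.instance Definition _ := Choice.copy (form I) (can_type form_encodeK).

End FormChoice.

(* [v] assigns truth values to the propositional atoms, which are the variables
   and the boxed formulas; its values at other formulas are irrelevant. *)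
Fixpoint beval (I : Type) (v : form I -> bool) (A : form I) : bool :=
  match A with
  | Bot => false
  | Top => true
  | Neg B => ~~ beval v B
  | And B C => beval v B && beval v C
  | Or B C => beval v B || beval v C
  | Imp B C => beval v B ==> beval v C
  | Var _ | Box _ _ => v A
  end.

Definition tautology (I : Type) (A : form I) : Prop :=
  forall v : form I -> bool, beval v A.

Inductive modal_axiom : Type := axD | axT | ax4.

Definition axiom_instance (I : Type) (i : I) (a : modal_axiom) (A : form I) :
    form I :=
  match a with
  | axD => Neg (Box i Bot)
  | axT => Imp (Box i A) A
  | ax4 => Imp (Box i A) (Box i (Box i A))
  end.

(* Theorems of the extension of the modal logic K by the axioms in [X]; its
   formulas have a single modality, whence the index type [unit]. *)
Inductive K_plus (X : modal_axiom -> Prop) : form unit -> Prop :=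
  | K_taut A : tautology A -> K_plus X A
  | K_dist A B :
      K_plus X (Imp (Box tt (Imp A B)) (Imp (Box tt A) (Box tt B)))
  | K_ax a A : X a -> K_plus X (axiom_instance tt a A)
  | K_mp A B : K_plus X (Imp A B) -> K_plus X A -> K_plus X B
  | K_nec A : K_plus X A -> K_plus X (Box tt A).

(* The logic F(i) is represented by a set [Fax i] of axioms that generates it
   over K; see [Flogic]. *)
Record description := Description {
  Nset : {fset nat};
  prec : rel Nset;
  prec_refl : reflexive prec;
  prec_anti : antisymmetric prec;
  prec_trans : transitive prec;
  Fax : Nset -> modal_axiom -> Prop
}.

Definition modality (d : description) : choiceType := fset_sub_type (Nset d).

Definition Flogic (d : description) (i : modality d) : form unit -> Prop :=
  K_plus (@Fax d i).

(* K + a is included in F(i). This is inclusion of theorems: KD is included in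
   F(i) also when F(i) = KT. *)
Definition includes (d : description) (a : modal_axiom) (i : modality d) : Prop :=
  forall A : form unit, K_plus (eq a) A -> Flogic i A.

Definition upward_closed (d : description) (a : modal_axiom) : Prop :=
  forall i j : modality d, prec i j -> includes a i -> includes a j.

Definition transitive_closed (d : description) : Prop := upward_closed d ax4.

Inductive logic (d : description) : form (modality d) -> Prop :=
  | L_taut A : tautology A -> logic A
  | L_dist (i : modality d) A B :
      logic (Imp (Box i (Imp A B)) (Imp (Box i A) (Box i B)))
  | L_ax (i : modality d) a A : Fax i a -> logic (axiom_instance i a A)
  | L_inter (i j : modality d) A : prec i j -> logic (Imp (Box j A) (Box i A))
  | L_mp A B : logic (Imp A B) -> logic A -> logic B
  | L_nec (i : modality d) A : logic A -> logic (Box i A).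

Record sequent (I : choiceType) := Sequent {
  ante : {mset form I};
  succ : {mset form I}
}.

Notation "G ⇒ D" := (Sequent G D) (at level 70, no associativity).

(* The linear nested sequent s_1 /_i1 s_2 /_i2 ... /_i(n-1) s_n is
   [(s_1, [:: (i1, s_2); ...; (i(n-1), s_n)])]. *)
Definition lns (I : choiceType) : Type := (sequent I * seq (I * sequent I))%type.

(* [graft [:: (s_1, i1); ...; (s_m, im)] S] is s_1 /_i1 ... s_m /_im S. *)
Fixpoint graft (I : choiceType) (G : seq (sequent I * I)) (S : lns I) : lns I :=
  match G with
  | [::] => S
  | (s, i) :: G' => let S' := graft G' S in (s, (i, S'.1) :: S'.2)
  end.

(* A linear nested sequent with a hole: the components, with their nesting
   operators, to the left and to the right of the hole. *)
Record context (I : choiceType) := Context {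
  left_part : seq (sequent I * I);
  right_part : seq (I * sequent I)
}.

(* S{s} *)
Definition fill (I : choiceType) (S : context I) (s : sequent I) : lns I :=
  graft (left_part S) (s, right_part S).

(* S{s /_j s'} *)
Definition fill2 (I : choiceType) (S : context I) (s : sequent I) (j : I)
    (s' : sequent I) : lns I :=
  graft (left_part S) (s, (j, s') :: right_part S).

(* Derivability in the linear nested sequent calculus with contraction and
   weakening. A multiset "Γ, A" or "A, Δ" is written [A +` G] or [A +` D]. The
   possibly empty prefix of the end-active rules is [G0]. *)
Inductive derivable (d : description) : lns (modality d) -> Prop :=
  | r_init S G D p : derivable (fill S (Var p +` G ⇒ Var p +` D))
  | r_botL S G D : derivable (fill S (Bot +` G ⇒ D))
  | r_topR S G D : derivable (fill S (G ⇒ Top +` D))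
  | r_negL S G D A :
      derivable (fill S (G ⇒ A +` D)) ->
      derivable (fill S (Neg A +` G ⇒ D))
  | r_negR S G D A :
      derivable (fill S (A +` G ⇒ D)) ->
      derivable (fill S (G ⇒ Neg A +` D))
  | r_orL S G D A B :
      derivable (fill S (A +` G ⇒ D)) ->
      derivable (fill S (B +` G ⇒ D)) ->
      derivable (fill S (Or A B +` G ⇒ D))
  | r_orR S G D A B :
      derivable (fill S (G ⇒ A +` (B +` D))) ->
      derivable (fill S (G ⇒ Or A B +` D))
  | r_andL S G D A B :
      derivable (fill S (A +` (B +` G) ⇒ D)) ->
      derivable (fill S (And A B +` G ⇒ D))
  | r_andR S G D A B :
      derivable (fill S (G ⇒ A +` D)) ->
      derivable (fill S (G ⇒ B +` D)) ->
      derivable (fill S (G ⇒ And A B +` D))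
  | r_impL S G D A B :
      derivable (fill S (B +` G ⇒ D)) ->
      derivable (fill S (G ⇒ A +` D)) ->
      derivable (fill S (Imp A B +` G ⇒ D))
  | r_impR S G D A B :
      derivable (fill S (A +` G ⇒ B +` D)) ->
      derivable (fill S (G ⇒ Imp A B +` D))
  | r_contrL S G D A :
      derivable (fill S (A +` (A +` G) ⇒ D)) ->
      derivable (fill S (A +` G ⇒ D))
  | r_contrR S G D A :
      derivable (fill S (G ⇒ A +` (A +` D))) ->
      derivable (fill S (G ⇒ A +` D))
  | r_weakL S G D A :
      derivable (fill S (G ⇒ D)) ->
      derivable (fill S (A +` G ⇒ D))
  | r_weakR S G D A :
      derivable (fill S (G ⇒ D)) ->
      derivable (fill S (G ⇒ A +` D))
  | r_boxL (i j : modality d) S G D G' D' A :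
      prec j i ->
      derivable (fill2 S (G ⇒ D) j (A +` G' ⇒ D')) ->
      derivable (fill2 S (Box i A +` G ⇒ D) j (G' ⇒ D'))
  | r_boxR (i : modality d) G0 G D A :
      derivable (graft G0 (G ⇒ D, [:: (i, mset0 ⇒ [mset A])])) ->
      derivable (graft G0 (G ⇒ Box i A +` D, [::]))
  | r_d (i j : modality d) G0 G D A :
      prec j i -> includes axD j ->
      derivable (graft G0 (G ⇒ D, [:: (j, [mset A] ⇒ mset0)])) ->
      derivable (graft G0 (Box i A +` G ⇒ D, [::]))
  | r_t (i : modality d) S G D A :
      includes axT i ->
      derivable (fill S (A +` G ⇒ D)) ->
      derivable (fill S (Box i A +` G ⇒ D))
  | r_4 (i j : modality d) S G D G' D' A :
      prec j i -> includes ax4 i ->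
      derivable (fill2 S (G ⇒ D) j (Box i A +` G' ⇒ D')) ->
      derivable (fill2 S (Box i A +` G ⇒ D) j (G' ⇒ D')).

(* Main.v *)
Require Import Defs.
From mathcomp Require Import all_boot.
From mathcomp Require Import finmap multiset.
From mathcomp Require Import boolp.

(* Soundness: read G => D /_i S as (/\G) -> (\/D) \/ Box_i S; every rule then
   preserves theoremhood, in any context since nesting is monotone for Box_i.

   Completeness avoids cut elimination: the logic is valid in all Kripke models
   with R_i included in R_j for i <= j whose relations satisfy the axioms of the
   F(i), so an underivable A needs a countermodel. Its worlds are the underivable
   one-component sequents that are maximal among those built from subformulas of
   A. A world sees another along R_i when the latter receives everything that the
   rules for Box_j with i <= j can push across the nesting operator /_i. Only the
   last two components of a linear nested sequent matter here, because a
   derivation of the last component alone can be prefixed by the others. *)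

Set Implicit Arguments.
Unset Strict Implicit.
Unset Printing Implicit Defensive.

Local Open Scope mset_scope.

(** * Derived principles of the multimodal logic *)

Section Logic.
Variable d : description.
Local Notation I := (modality d).
Local Notation fm := (form I).

Lemma logic_conseq1 (X Y : fm) :
  tautology (Imp X Y) -> logic X -> logic Y.
Proof. by move=> /L_taut; apply: L_mp. Qed.

Lemma logic_conseq2 (X Y Z : fm) :
  tautology (Imp X (Imp Y Z)) -> logic X -> logic Y -> logic Z.
Proof. by move=> t x; apply/L_mp/(logic_conseq1 t). Qed.

Lemma logic_trans (X Y Z : fm) :
  logic (Imp X Y) -> logic (Imp Y Z) -> logic (Imp X Z).
Proof.
by apply: logic_conseq2 => v /=; case: (beval v X) (beval v Y) (beval v Z) => [] [] [].
Qed.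

Lemma logic_dup (X Y : fm) : logic (Imp X Y) -> logic (Imp X (Imp X Y)).
Proof.
by apply: logic_conseq1 => v /=; case: (beval v X) (beval v Y) => [] [].
Qed.

Lemma logic_box_mono (i : I) (X Y : fm) :
  logic (Imp X Y) -> logic (Imp (Box i X) (Box i Y)).
Proof. by move=> /(L_nec i); apply/L_mp/L_dist. Qed.

Lemma logic_box_mono2 (i : I) (X Y Z : fm) :
  logic (Imp X (Imp Y Z)) -> logic (Imp (Box i X) (Imp (Box i Y) (Box i Z))).
Proof. by move=> /(logic_box_mono i) h; apply: logic_trans h (L_dist _ _ _). Qed.

Fixpoint subst_form (i : I) (s : nat -> fm) (B : form unit) : fm :=
  match B with
  | Var p => s p
  | Bot => Bot
  | Top => Top
  | Neg B => Neg (subst_form i s B)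
  | And B C => And (subst_form i s B) (subst_form i s C)
  | Or B C => Or (subst_form i s B) (subst_form i s C)
  | Imp B C => Imp (subst_form i s B) (subst_form i s C)
  | Box _ B => Box i (subst_form i s B)
  end.

Lemma beval_subst i s v (B : form unit) :
  beval v (subst_form i s B) = beval (fun C => beval v (subst_form i s C)) B.
Proof. by elim: B => //= [A ->|A -> B ->|A -> B ->|A -> B ->]. Qed.

(** Reading the single box as [Box i] maps a [K_plus] derivation rule by rule; tautologies survive
    because a valuation composed with the substitution is again a valuation. *)
Lemma logic_Flogic i s (B : form unit) : Flogic i B -> logic (subst_form i s B).
Proof.
elim=> {B} [B tB|B C|a B iB|B C _ IHB _|B _] /=.
- by apply: L_taut => v; rewrite beval_subst.
- exact: L_dist.
(* Axiom D ignores its formula argument; [Bot] is an arbitrary filler. *)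
- by case: a iB => iB; [apply: (L_ax Bot iB)|apply: (L_ax _ iB)|apply: (L_ax _ iB)].
- exact: L_mp.
- exact: L_nec.
Qed.

(** Inclusion speaks of theorems, so it is applied to the axiom for one variable, and [A] is then
    substituted for that variable. *)
Lemma logic_includes (a : modal_axiom) i (A : fm) :
  includes a i -> logic (axiom_instance i a A).
Proof.
move=> /(_ (axiom_instance tt a (Var 0)) (K_ax _ erefl)).
by move=> /(logic_Flogic (fun _ => A)); case: a.
Qed.

(** Links the generating axioms, on which [logic] depends, with the side conditions of the rules,
    which are stated by [includes]. *)
Lemma Fax_includes (a : modal_axiom) (i : I) : Fax i a -> includes a i.
Proof.
move=> ia A; rewrite /Flogic; elim=> {A}.
- exact: K_taut.
- exact: K_dist.
- by move=> _ A <-; apply: K_ax.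
- by move=> A B _ IHA _; apply: K_mp.
- by move=> A _; apply: K_nec.
Qed.

End Logic.

(** * Soundness through the formula reading of linear nested sequents *)

Section Soundness.
Variable d : description.
Local Notation I := (modality d).
Local Notation fm := (form I).

(** The order of the fold comes from an arbitrary enumeration of the multiset, so these formulas are
    compared only through their truth values. *)
Definition bigand (G : {mset fm}) : fm := foldr (@And I) Top G.
Definition bigor (D : {mset fm}) : fm := foldr (@Or I) Bot D.

Fixpoint tail_form (l : seq (I * sequent I)) : fm :=
  match l with
  | [::] => Bot
  | (i, s) :: l' =>
      Box i (Imp (bigand (ante s)) (Or (bigor (succ s)) (tail_form l')))
  end.

Definition lns_form (S : lns I) : fm :=
  Imp (bigand (ante S.1)) (Or (bigor (succ S.1)) (tail_form S.2)).

Lemma beval_bigand v G : beval v (bigand G) = all (beval v) G.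
Proof. by rewrite /bigand; elim: (G : seq _) => //= x s ->. Qed.

Lemma beval_bigor v D : beval v (bigor D) = has (beval v) D.
Proof. by rewrite /bigor; elim: (D : seq _) => //= x s ->. Qed.

Lemma beval_bigandD1 v A G :
  beval v (bigand (A +` G)) = beval v A && beval v (bigand G).
Proof.
rewrite !beval_bigand; apply/allP/andP => [h|[hA /allP hG] x].
  split; first by apply: h; rewrite in_mset1D eqxx.
  by apply/allP => x xG; apply: h; rewrite in_mset1D xG orbT.
by rewrite in_mset1D => /orP[/eqP->|/hG].
Qed.

Lemma beval_bigorD1 v A D :
  beval v (bigor (A +` D)) = beval v A || beval v (bigor D).
Proof.
rewrite !beval_bigor; apply/hasP/orP => [[x]|[hA|/hasP[x xD hx]]].
- rewrite in_mset1D => /orP[/eqP-> ->|xD hx]; first by left.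
  by right; apply/hasP; exists x.
- by exists A; rewrite // in_mset1D eqxx.
- by exists x; rewrite // in_mset1D xD orbT.
Qed.

Lemma beval_bigand0 v : beval v (bigand mset0).
Proof. by rewrite beval_bigand; apply/allP => x; rewrite in_mset0. Qed.

Lemma beval_bigor0 v : beval v (bigor mset0) = false.
Proof. by rewrite beval_bigor; apply/hasP => -[x]; rewrite in_mset0. Qed.

Lemma beval_bigand1 v A : beval v (bigand [mset A]) = beval v A.
Proof.
rewrite beval_bigand; apply/allP/idP => [|hA x]; first by apply; rewrite in_mset1.
by rewrite in_mset1 => /eqP->.
Qed.

Lemma beval_bigor1 v A : beval v (bigor [mset A]) = beval v A.
Proof.
rewrite beval_bigor; apply/hasP/idP => [[x]|hA]; last by exists A; rewrite ?in_mset1.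
by rewrite in_mset1 => /eqP->.
Qed.

Definition bevalE := (beval_bigandD1, beval_bigorD1, beval_bigand0, beval_bigor0,
  beval_bigand1, beval_bigor1).

(** Serves the zero-premiss rules: necessitation makes the boxed tail a theorem, and that tail is a
    disjunct of the enclosing reading. *)
Lemma graft_form0 G S : logic (lns_form S) -> logic (lns_form (graft G S)).
Proof.
move=> hS; elim: G => [|[s i] G IHG] //=.
apply: logic_conseq1 (L_nec i IHG) => v /=.
by rewrite /lns_form /=; case: (v _); rewrite ?orbT ?implybT.
Qed.

(** The hole occurs positively under boxes: normality carries the implication through each box, and
    the enclosing component adds the same antecedent and disjuncts to all three formulas. *)
Lemma graft_form2 G S1 S2 S :
  logic (Imp (lns_form S1) (Imp (lns_form S2) (lns_form S))) ->
  logic (Imp (lns_form (graft G S1))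
          (Imp (lns_form (graft G S2)) (lns_form (graft G S)))).
Proof.
move=> h; elim: G => [|[s i] G IHG] //=.
apply: logic_conseq1 (logic_box_mono2 i IHG) => v /=.
rewrite /lns_form /=.
by case: (beval v (bigand _)) (beval v (bigor _)) => [] [] //=; rewrite ?orbT ?implybT ?implybb.
Qed.

Lemma graft_rule2 G S1 S2 S :
  logic (Imp (lns_form S1) (Imp (lns_form S2) (lns_form S))) ->
  logic (lns_form (graft G S1)) -> logic (lns_form (graft G S2)) ->
  logic (lns_form (graft G S)).
Proof. by move=> /(graft_form2 G) h h1; apply/L_mp/(L_mp h h1). Qed.

Lemma graft_rule1 G S1 S :
  logic (Imp (lns_form S1) (lns_form S)) ->
  logic (lns_form (graft G S1)) -> logic (lns_form (graft G S)).
Proof.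
by move=> h h1; apply: (graft_rule2 (logic_dup h) h1 h1).
Qed.

Ltac beval_cases :=
  let v := fresh "v" in move=> v; rewrite /lns_form /= ?bevalE /=;
  repeat match goal with
  | |- context [beval v ?A] => case: (beval v A) => //=
  | |- context [v ?A] => case: (v A) => //=
  end.

(** Common core of [r_boxL], [r_d] and [r_4]: [B] is the box of the earlier component; once it
    yields [Box j A], the antecedent [A] can be discharged under [Box j]. *)
Lemma logic_push (j : I) (B A : fm) G D R :
  logic (Imp B (Box j A)) ->
  logic (Imp B (Imp (tail_form ((j, A +` G ⇒ D) :: R))
                    (tail_form ((j, G ⇒ D) :: R)))).
Proof.
move=> h; apply: logic_trans h _; apply/logic_box_mono2/L_taut.
by beval_cases.
Qed.

Lemma derivable_sound (S : lns I) : derivable S -> logic (lns_form S).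
Proof.
elim=> {S}.
- by move=> [L R] G D p; apply: graft_form0; apply: L_taut => v; rewrite /lns_form /= ?bevalE /=; case: (v _) => /=; rewrite ?implybT.
- by move=> [L R] G D; apply: graft_form0; apply: L_taut; beval_cases.
- by move=> [L R] G D; apply: graft_form0; apply: L_taut; beval_cases.
- by move=> [L R] G D A _; apply: graft_rule1; apply: L_taut; beval_cases.
- by move=> [L R] G D A _; apply: graft_rule1; apply: L_taut; beval_cases.
- by move=> [L R] G D A B _ h _; apply: (graft_rule2 _ h); apply: L_taut; beval_cases.
- by move=> [L R] G D A B _; apply: graft_rule1; apply: L_taut; beval_cases.
- by move=> [L R] G D A B _; apply: graft_rule1; apply: L_taut; beval_cases.
- by move=> [L R] G D A B _ h _; apply: (graft_rule2 _ h); apply: L_taut; beval_cases.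
- by move=> [L R] G D A B _ h _; apply: (graft_rule2 _ h); apply: L_taut; beval_cases.
- by move=> [L R] G D A B _; apply: graft_rule1; apply: L_taut; beval_cases.
- by move=> [L R] G D A _; apply: graft_rule1; apply: L_taut; beval_cases.
- by move=> [L R] G D A _; apply: graft_rule1; apply: L_taut; beval_cases.
- by move=> [L R] G D A _; apply: graft_rule1; apply: L_taut; beval_cases.
- by move=> [L R] G D A _; apply: graft_rule1; apply: L_taut; beval_cases.
- move=> i j [L R] G D G' D' A ji _; apply: graft_rule1.
  by apply: logic_conseq1 (logic_push G' D' R (L_inter A ji)); beval_cases.
- move=> i L G D A _; apply: graft_rule1.
  have h : logic (Imp (tail_form [:: (i, mset0 ⇒ [mset A])]) (Box i A)).
    by apply/logic_box_mono/L_taut; beval_cases.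
  by apply: logic_conseq1 h; beval_cases.
- move=> i j L G D A ji Dj _; apply: graft_rule1.
  (* Discharging [A] leaves an empty last component, whose reading implies [Box j Bot] and is
     refuted by axiom D at [j]. *)
  have h := logic_push mset0 mset0 [::] (L_inter A ji).
  have hbot : logic (Imp (tail_form [:: (j, mset0 ⇒ mset0)]) (Box j Bot)).
    by apply/logic_box_mono/L_taut; beval_cases.
  rewrite msetD0 in h.
  have {}hbot : logic (Neg (tail_form [:: (j, mset0 ⇒ mset0)])).
    by apply: logic_conseq2 hbot (logic_includes Bot Dj); beval_cases.
  by apply: logic_conseq2 h hbot; beval_cases.
- move=> i [L R] G D A Ti _; apply: graft_rule1.
  by apply: logic_conseq1 (logic_includes A Ti); beval_cases.
- move=> i j [L R] G D G' D' A ji i4 _; apply: graft_rule1.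
  (* Axiom 4 gives [Box i (Box i A)], and interaction along [prec j i] turns the outer box into
     [Box j]. *)
  have h := logic_trans (logic_includes A i4) (L_inter (Box i A) ji).
  by apply: logic_conseq1 (logic_push G' D' R h); beval_cases.
Qed.

End Soundness.

(** * Kripke semantics and validity of the logic *)

Section Kripke.
Variable d : description.
Local Notation I := (modality d).
Local Notation fm := (form I).

Fixpoint sat (W : Type) (R : I -> W -> W -> Prop) (V : nat -> W -> Prop) (w : W)
    (A : fm) : Prop :=
  match A with
  | Var p => V p w
  | Bot => False
  | Top => True
  | Neg B => ~ sat R V w B
  | And B C => sat R V w B /\ sat R V w C
  | Or B C => sat R V w B \/ sat R V w C
  | Imp B C => sat R V w B -> sat R V w C
  | Box i B => forall w', R i w w' -> sat R V w' B
  end.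

Definition satisfies_axiom (W : Type) (R : W -> W -> Prop) (a : modal_axiom) : Prop :=
  match a with
  | axD => forall w, exists w', R w w'
  | axT => forall w, R w w
  | ax4 => forall u v w, R u v -> R v w -> R u w
  end.

(** Classically, truth at a world is a Boolean valuation of the atoms, so tautologies hold at every
    world. *)
Lemma beval_sat W (R : I -> W -> W -> Prop) V w A :
  beval (fun B => `[< sat R V w B >]) A = `[< sat R V w A >].
Proof.
elim: A => //= [|| A -> | A -> B -> | A -> B -> | A -> B ->].
- by apply/esym/asboolP => -[].
- by apply/esym/asboolP.
- by rewrite -asbool_neg.
- by rewrite -asbool_and.
- by rewrite -asbool_or.
- by rewrite asbool_imply.
Qed.

Lemma logic_sat W (R : I -> W -> W -> Prop) V A :
  (forall i j w w', prec i j -> R i w w' -> R j w w') ->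
  (forall i a, Fax i a -> satisfies_axiom (R i) a) ->
  logic A -> forall w, sat R V w A.
Proof.
move=> Rprec Rax; elim=> {A}.
- by move=> A tA w; apply/asboolP; rewrite -beval_sat.
- by move=> i A B w /= hAB hA w' Rw; apply: hAB Rw (hA _ Rw).
- move=> i [] A /Rax /= Ri w.
  + by have [w' Rw] := Ri w; move=> /(_ _ Rw).
  + by apply; apply: Ri.
  + by move=> h u Ru v Rv; apply/h/Ri/Rv.
- by move=> i j A ij w /= h w' /(Rprec _ _ _ _ ij); apply: h.
- by move=> A B _ IHAB _ IHA w; apply/IHAB/IHA.
- by move=> i A _ IHA w w' _; apply: IHA.
Qed.

End Kripke.

(** * Prefixing, contraction and transfer of boxes in the calculus *)

Section Completeness.
Variable d : description.
Local Notation I := (modality d).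
Local Notation fm := (form I).

Lemma graft_cat G1 G2 (S : lns I) : graft (G1 ++ G2) S = graft G1 (graft G2 S).
Proof. by elim: G1 => [|[s i] G1 IHG] //=; rewrite IHG. Qed.

(** A prefix keeps the last component last, so [r_boxR] and [r_d] still apply; for the other rules
    it is absorbed into the context. *)
Lemma derivable_graft G0 (S : lns I) : derivable S -> derivable (graft G0 S).
Proof.
have fillE C s :
    graft G0 (fill C s) = fill (Context (G0 ++ left_part C) (right_part C)) s.
  by rewrite /fill graft_cat.
have fill2E C s j s' :
    graft G0 (fill2 C s j s') =
      fill2 (Context (G0 ++ left_part C) (right_part C)) s j s'.
  by rewrite /fill2 graft_cat.
elim=> {S}.
- by move=> *; rewrite fillE; apply: r_init.
- by move=> *; rewrite fillE; apply: r_botL.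
- by move=> *; rewrite fillE; apply: r_topR.
- by move=> C G D A _; rewrite !fillE; apply: r_negL.
- by move=> C G D A _; rewrite !fillE; apply: r_negR.
- by move=> C G D A B _ + _; rewrite !fillE; apply: r_orL.
- by move=> C G D A B _; rewrite !fillE; apply: r_orR.
- by move=> C G D A B _; rewrite !fillE; apply: r_andL.
- by move=> C G D A B _ + _; rewrite !fillE; apply: r_andR.
- by move=> C G D A B _ + _; rewrite !fillE; apply: r_impL.
- by move=> C G D A B _; rewrite !fillE; apply: r_impR.
- by move=> C G D A _; rewrite !fillE; apply: r_contrL.
- by move=> C G D A _; rewrite !fillE; apply: r_contrR.
- by move=> C G D A _; rewrite !fillE; apply: r_weakL.
- by move=> C G D A _; rewrite !fillE; apply: r_weakR.
- by move=> i j C G D G' D' A ji _; rewrite !fill2E; apply: r_boxL.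
- by move=> i C G D A _; rewrite -!graft_cat; apply: r_boxR.
- by move=> i j C G D A ji Dj _; rewrite -!graft_cat; apply: r_d.
- by move=> i C G D A Ti _; rewrite !fillE; apply: r_t.
- by move=> i j C G D G' D' A ji i4 _; rewrite !fill2E; apply: r_4.
Qed.

(** Contraction lets a rule consume one copy of [A] while [G] persists, so [G] behaves like a
    set. *)
Lemma contrL_mem (C : context I) (G D : {mset fm}) A :
  A \in G -> derivable (fill C (A +` G ⇒ D)) -> derivable (fill C (G ⇒ D)).
Proof. by move=> /msetB1K <-; apply: r_contrL. Qed.

Lemma contrR_mem (C : context I) (G D : {mset fm}) A :
  A \in D -> derivable (fill C (G ⇒ A +` D)) -> derivable (fill C (G ⇒ D)).
Proof. by move=> /msetB1K <-; apply: r_contrR. Qed.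

(* What a formula of an antecedent contributes to the next component across /_i. *)
Definition push (i : I) (A : fm) : seq fm :=
  match A with
  | Box j B =>
      if prec i j then B :: (if `[< includes ax4 j >] then [:: A] else [::])
      else [::]
  | _ => [::]
  end.

(** Each box in [s] is copied by contraction and the copy consumed by [r_boxL] or [r_4]; [G] is thus
    unchanged and the induction on [s] continues. *)
Lemma derivable_push (i : I) (s : seq fm) (G D G' D' : {mset fm}) :
  {subset s <= G} ->
  derivable (G ⇒ D, [:: (i, seq_mset (flatten (map (push i) s)) `+` G' ⇒ D')]) ->
  derivable (G ⇒ D, [:: (i, G' ⇒ D')]).
Proof.
elim: s => [|A s IHs] sG /=.
  by rewrite (_ : seq_mset [::] = mset0) ?mset0D //; apply/msetP => x; rewrite mset_seqE mset0E.
have AG : A \in G by apply: sG; rewrite mem_head.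
have {}IHs := IHs (fun x xs => sG x (@mem_behead _ (A :: s) x xs)).
have boxL j B X : A = Box j B -> prec i j ->
    derivable (G ⇒ D, [:: (i, B +` X ⇒ D')]) ->
    derivable (G ⇒ D, [:: (i, X ⇒ D')]).
  move=> AE ij h.
  apply: (@contrL_mem (Context [::] [:: (i, X ⇒ D')]) _ _ A) => //.
  by rewrite AE; apply: (@r_boxL d j i (Context [::] [::])).
have box4 j B X : A = Box j B -> prec i j -> includes ax4 j ->
    derivable (G ⇒ D, [:: (i, A +` X ⇒ D')]) ->
    derivable (G ⇒ D, [:: (i, X ⇒ D')]).
  move=> AE ij j4 h.
  apply: (@contrL_mem (Context [::] [:: (i, X ⇒ D')]) _ _ A) => //.
  by rewrite AE in h *; apply: (@r_4 d j i (Context [::] [::])).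
move: boxL box4; case: A AG {sG} => //= j B _ boxL box4.
case: ifP => //= ij.
case: asboolP => [j4|_] /=; rewrite !mset_cons -!msetDA => h.
  (* Under 4 the box is used twice: to pass on [B] and to pass on itself. *)
  by apply/IHs/(box4 j B) => //; apply/(boxL j B).
by apply/IHs/(boxL j B).
Qed.

Fixpoint subforms (A : fm) : seq fm :=
  A :: match A with
       | Neg B | Box _ B => subforms B
       | And B C | Or B C | Imp B C => subforms B ++ subforms C
       | _ => [::]
       end.

Lemma subforms_refl A : A \in subforms A.
Proof. by case: A => *; rewrite mem_head. Qed.

Lemma subforms_trans A B C :
  A \in subforms B -> B \in subforms C -> A \in subforms C.
Proof.
move=> AB; elim: C => [p|||C IH|C IHC E IHE|C IHC E IHE|C IHC E IHE|i C IH] /=;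
  rewrite [B \in _]in_cons => /orP[/eqP BE|//]; try by rewrite BE in AB.
1,5: by move=> /IH h; rewrite in_cons h orbT.
all: by rewrite in_cons !mem_cat => /orP[/IHC|/IHE] ->; rewrite !orbT.
Qed.

(** * The countermodel of maximal underivable sequents *)

Section Countermodel.
Variable F : fm.
Local Notation S := (subforms F).

(** Maximality concerns membership, not multiplicity. No field places every subformula on one of the
    two sides: deducing that from maximality would take a cut. *)
Record world := World {
  wL : {mset fm};
  wR : {mset fm};
  wL_sub : {subset wL <= S};
  wR_sub : {subset wR <= S};
  w_nder : ~ derivable (wL ⇒ wR, [::]);
  wL_max : forall A, A \in S -> A \notin wL -> derivable (A +` wL ⇒ wR, [::]);
  wR_max : forall A, A \in S -> A \notin wR -> derivable (wL ⇒ A +` wR, [::])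
}.

(** Termination measure for the extension to a world. The list [S] may repeat formulas; the count
    drops by the number of occurrences of [A], which is positive. *)
Lemma count_notin_lt (G : {mset fm}) A :
  A \in S -> A \notin G ->
  count (fun x => x \notin A +` G) S < count (fun x => x \notin G) S.
Proof.
move=> AS AG.
have -> : count (fun x => x \notin G) S =
    count (fun x => x \notin A +` G) S + count_mem A S.
  rewrite -(count_predUI (fun x => x \notin A +` G)) -[LHS]addn0; congr (_ + _).
    apply: eq_count => x /=; rewrite in_mset1D negb_or.
    by case: eqP => [->|_] /=; rewrite ?AG ?orbF.
  rewrite (eq_count (a2 := pred0)) ?count_pred0 // => x /=.
  by rewrite in_mset1D negb_or; case: eqP => //=; rewrite andbF.
by rewrite -addn1 leq_add2l -has_count has_pred1.
Qed.

(** Subformulas are added to either side while the sequent stays underivable; the number of missing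
    entries drops, and when no addition is possible both maximality clauses hold. *)
Lemma lindenbaum (G D : {mset fm}) :
  {subset G <= S} -> {subset D <= S} -> ~ derivable (G ⇒ D, [::]) ->
  exists w : world, {subset G <= wL w} /\ {subset D <= wR w}.
Proof.
have [n] := ubnP (count (fun x => x \notin G) S + count (fun x => x \notin D) S).
elim: n G D => // n IHn G D lt_n GS DS nder.
have [[A [AS AG ndA]]|maxL] :=
    pselect (exists A, [/\ A \in S, A \notin G & ~ derivable (A +` G ⇒ D, [::])]).
  have [|x|w [sG sD]] := IHn (A +` G) D _ _ DS ndA.
  - by rewrite -ltnS; apply: leq_trans lt_n; rewrite ltnS ltn_add2r count_notin_lt.
  - by rewrite in_mset1D => /orP[/eqP->|/GS].
  by exists w; split=> // x xG; apply: sG; rewrite in_mset1D xG orbT.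
have [[A [AS AD ndA]]|maxR] :=
    pselect (exists A, [/\ A \in S, A \notin D & ~ derivable (G ⇒ A +` D, [::])]).
  have [|x|w [sG sD]] := IHn G (A +` D) _ GS _ ndA.
  - by rewrite -ltnS; apply: leq_trans lt_n; rewrite ltnS ltn_add2l count_notin_lt.
  - by rewrite in_mset1D => /orP[/eqP->|/DS].
  by exists w; split=> // x xD; apply: sD; rewrite in_mset1D xD orbT.
have hL A : A \in S -> A \notin G -> derivable (A +` G ⇒ D, [::]).
  by move=> AS AG; apply: contrapT => ndA; apply: maxL; exists A.
have hR A : A \in S -> A \notin D -> derivable (G ⇒ A +` D, [::]).
  by move=> AS AD; apply: contrapT => ndA; apply: maxR; exists A.
by exists (World GS DS nder hL hR); split.
Qed.

Definition wrel (i : I) (w w' : world) : Prop :=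
  forall j B, prec i j -> Box j B \in wL w ->
    B \in wL w' /\ (includes ax4 j -> Box j B \in wL w').

Definition wval (p : nat) (w : world) : Prop := Var p \in wL w.

(** With [w_nderL], this identifies the left side with the subformulas whose addition there keeps
    the sequent underivable. *)
Lemma wL_in w A : A \in S -> ~ derivable (A +` wL w ⇒ wR w, [::]) -> A \in wL w.
Proof. by move=> AS; apply: contra_notT => /(wL_max AS). Qed.

Lemma wR_in w A : A \in S -> ~ derivable (wL w ⇒ A +` wR w, [::]) -> A \in wR w.
Proof. by move=> AS; apply: contra_notT => /(wR_max AS). Qed.

Local Notation hole := (Context [::] [::]).

Lemma w_nderL w A : A \in wL w -> ~ derivable (A +` wL w ⇒ wR w, [::]).
Proof. by move=> Aw /(@contrL_mem hole _ _ _ Aw) /w_nder. Qed.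

Lemma w_nderR w A : A \in wR w -> ~ derivable (wL w ⇒ A +` wR w, [::]).
Proof. by move=> Aw /(@contrR_mem hole _ _ _ Aw) /w_nder. Qed.

Lemma mem_push i j B (s : seq fm) :
  prec i j -> Box j B \in s -> B \in flatten (map (push i) s) /\
  (includes ax4 j -> Box j B \in flatten (map (push i) s)).
Proof.
move=> ij Bs; split=> [|j4]; apply/flattenP; exists (push i (Box j B));
  rewrite ?map_f //= ij ?mem_head //.
by rewrite (asboolT j4) !inE eqxx orbT.
Qed.

Lemma push_subforms i (s : seq fm) :
  {subset s <= S} -> {subset flatten (map (push i) s) <= S}.
Proof.
move=> sS A /flattenP[_ /mapP[B /sS BS ->]].
have sub C : C \in subforms B -> C \in S by move=> /subforms_trans; apply.
case: B BS sub => //= j B _ sub; case: ifP => // _; rewrite inE => /orP[/eqP->|].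
  by apply: sub; rewrite in_cons subforms_refl orbT.
by case: ifP => // _; rewrite inE => /eqP->; apply: sub; rewrite mem_head.
Qed.

(** The successor extends the last component enriched by all that [w] pushes across the nesting
    operator. Were that component derivable alone, prefixing [w] and undoing the pushes would derive
    the two-component sequent. *)
Lemma wrel_exists i w (G D : {mset fm}) :
  {subset G <= S} -> {subset D <= S} ->
  ~ derivable (wL w ⇒ wR w, [:: (i, G ⇒ D)]) ->
  exists w', [/\ wrel i w w', {subset G <= wL w'} & {subset D <= wR w'}].
Proof.
move=> GS DS nder.
pose P := flatten (map (push i) (wL w)).
have memP x : (x \in seq_mset P) = (x \in P) by apply/perm_mem/perm_eq_seq_mset.
have [x||w' [sG sD]] := @lindenbaum (seq_mset P `+` G) D _ DS.
- rewrite in_msetD memP => /orP[|/GS //].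
  by apply: push_subforms; apply: wL_sub.
- move=> h; apply: nder; apply: (@derivable_push i (wL w)) => //.
  exact: (derivable_graft [:: (wL w ⇒ wR w, i)] h).
exists w'; split=> // [j B ij Bw|x xG]; last by apply: sG; rewrite in_msetD xG orbT.
have [BP B4] := mem_push ij Bw; split=> [|/B4 {}B4]; apply: sG.
  by rewrite in_msetD memP BP.
by rewrite in_msetD memP B4.
Qed.

Lemma wrel_prec i j w w' : prec i j -> wrel i w w' -> wrel j w w'.
Proof. by move=> ij h k B jk; apply: h; apply: prec_trans ij jk. Qed.

(** For D, a successor is built from the premiss of [r_d]. For T and 4, [wrel i] concerns all boxes
    [Box j] with [j] above [i], so the axiom has to be lifted from [i] to [j] by upward closure. *)
Lemma wrel_axiom i a :
  upward_closed d axT -> transitive_closed d ->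
  includes a i -> satisfies_axiom (wrel i) a.
Proof.
move=> upT up4; case: a => [Di w|Ti w|i4 u v w uv vw].
- have [[j [B [ij Bw]]]|nobox] := pselect (exists j B, prec i j /\ Box j B \in wL w).
    have BS : B \in S.
      apply: subforms_trans (wL_sub Bw) => /=.
      by rewrite in_cons subforms_refl orbT.
    have [x|x||w' []] := @wrel_exists i w [mset B] mset0.
    + by rewrite in_mset1 => /eqP->.
    + by rewrite in_mset0.
    + by move=> h; apply: (w_nderL Bw); apply: (@r_d d j i [::]).
    + by exists w'.
  (* Rule d needs a box to act on; without one every world is a successor. *)
  by exists w => j B ij Bw; case: nobox; exists j, B.
- move=> j B ij Bw; split=> //; apply: wL_in.
    by apply: subforms_trans (wL_sub Bw); rewrite /= in_cons subforms_refl orbT.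
  by move=> h; apply: (w_nderL Bw); apply: (@r_t d j hole) => //; apply: upT Ti.
- move=> j B ij Bu; have j4 := up4 _ _ ij i4.
  by have [_ /(_ j4) Bv] := uv _ _ ij Bu; apply: vw.
Qed.

(** The two sides are treated by separate implications: each left or right rule, read upwards,
    passes its principal formula's status on to subformulas, without cut. *)
Lemma truth A w : A \in S ->
  (A \in wL w -> sat wrel wval w A) /\ (A \in wR w -> ~ sat wrel wval w A).
Proof.
(* A premiss may add two subformulas at once, while maximality speaks of one; weakening bridges the
   gap. *)
have weakL w0 X Y : derivable (X +` wL w0 ⇒ wR w0, [::]) ->
    derivable (X +` (Y +` wL w0) ⇒ wR w0, [::]).
  by move=> h; rewrite msetDCA; apply: (@r_weakL d hole).
have weakR w0 X Y : derivable (wL w0 ⇒ X +` wR w0, [::]) ->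
    derivable (wL w0 ⇒ X +` (Y +` wR w0), [::]).
  by move=> h; rewrite msetDCA; apply: (@r_weakR d hole).
elim: A w => [p|||A IHA|A IHA B IHB|A IHA B IHB|A IHA B IHB|i A IHA] w AS;
  have sub C : C \in subforms _ -> C \in S := fun h => subforms_trans h AS.
- split=> //= Rp Lp; apply: (w_nder (w := w)); rewrite -(msetB1K Rp) -(msetB1K Lp).
  exact: (@r_init d hole).
- split=> [Lb|_ []]; case: (w_nderL Lb); apply: (@r_botL d hole).
- split=> [//|Rt _]; case: (w_nderR Rt); apply: (@r_topR d hole).
- have A_S : A \in S by apply: sub; rewrite /= in_cons subforms_refl orbT.
  have [IHL IHR] := IHA w A_S; split=> /= [Lw|Rw].
    by apply/IHR/wR_in => // h; apply: (w_nderL Lw); apply: (@r_negL d hole).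
  apply; apply/IHL/wL_in => // h; apply: (w_nderR Rw); exact: (@r_negR d hole).
- have A_S : A \in S by apply: sub; rewrite /= in_cons mem_cat subforms_refl orbT.
  have B_S : B \in S by apply: sub; rewrite /= in_cons mem_cat subforms_refl !orbT.
  have [IHAL IHAR] := IHA w A_S; have [IHBL IHBR] := IHB w B_S; split=> /= [Lw|Rw].
    split; [apply/IHAL/wL_in => // h|apply/IHBL/wL_in => // h];
      apply: (w_nderL Lw); apply: (@r_andL d hole).
      exact: weakL.
    by rewrite msetDCA; apply: weakL.
  (* If neither conjunct is on the right, maximality derives both premisses of [r_andR]; the other
     two-premiss rules are used likewise. *)
  have [RA|/wR_max -/(_ A_S) hA] := boolP (A \in wR w); first by case=> + _; apply: IHAR.
  have [RB|/wR_max -/(_ B_S) hB] := boolP (B \in wR w); first by case=> _; apply: IHBR.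
  by case: (w_nderR Rw); apply: (@r_andR d hole).
- have A_S : A \in S by apply: sub; rewrite /= in_cons mem_cat subforms_refl orbT.
  have B_S : B \in S by apply: sub; rewrite /= in_cons mem_cat subforms_refl !orbT.
  have [IHAL IHAR] := IHA w A_S; have [IHBL IHBR] := IHB w B_S; split=> /= [Lw|Rw].
    have [LA|/wL_max -/(_ A_S) hA] := boolP (A \in wL w); first by left; apply: IHAL.
    have [LB|/wL_max -/(_ B_S) hB] := boolP (B \in wL w); first by right; apply: IHBL.
    by case: (w_nderL Lw); apply: (@r_orL d hole).
  case; [apply/IHAR/wR_in => // h|apply/IHBR/wR_in => // h];
    apply: (w_nderR Rw); apply: (@r_orR d hole).
    exact: weakR.
  by rewrite msetDCA; apply: weakR.
- have A_S : A \in S by apply: sub; rewrite /= in_cons mem_cat subforms_refl orbT.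
  have B_S : B \in S by apply: sub; rewrite /= in_cons mem_cat subforms_refl !orbT.
  have [IHAL IHAR] := IHA w A_S; have [IHBL IHBR] := IHB w B_S; split=> /= [Lw hA|Rw h].
    have [LB|/wL_max -/(_ B_S) hB] := boolP (B \in wL w); first exact: IHBL.
    have [RA|/wR_max -/(_ A_S) hA'] := boolP (A \in wR w); first by case: (IHAR RA).
    by case: (w_nderL Lw); apply: (@r_impL d hole).
  apply: IHBR (h _).
    apply: wR_in => // hB; apply: (w_nderR Rw); apply: (@r_impR d hole).
    exact: (@r_weakL d hole).
  apply/IHAL/wL_in => // hA; apply: (w_nderR Rw); apply: (@r_impR d hole).
  exact: (@r_weakR d hole).
- have A_S : A \in S by apply: sub; rewrite /= in_cons subforms_refl orbT.
  split=> /= [Lw w' /(_ _ _ (prec_refl i) Lw)[LA _]|Rw hA].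
    by have [+ _] := IHA w' A_S; apply.
  (* The two-component sequent is the premiss of [r_boxR]; its underivability yields a successor
     refuting [A]. *)
  have [x|x||w' [Rww' _ RA]] := @wrel_exists i w mset0 [mset A].
  + by rewrite in_mset0.
  + by rewrite in_mset1 => /eqP->.
  + by move=> h; apply: (w_nderR Rw); apply: (@r_boxR d i [::]).
  have [_] := IHA w' A_S; apply; last exact: hA.
  by apply: RA; rewrite in_mset1.
Qed.

End Countermodel.
End Completeness.

Theorem mainTheorem4 (d : description)
    (hD : upward_closed d axD) (hT : upward_closed d axT)
    (h4 : transitive_closed d) (A : form (modality d)) :
  logic A <-> derivable (mset0 ⇒ [mset A], [::]).
Proof.
split=> [logicA|/derivable_sound]; last first.
  (* The reading of the one-component sequent is [A] up to an empty conjunction and [Bot]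
     disjuncts. *)
  apply: logic_conseq1 => v /=.
  by rewrite ?bevalE /= orbF; apply/implyP.
apply: contrapT => nder.
(* This world has [A] on its right, so the truth lemma refutes [A] there, although the model
   validates the logic. *)
have [x|x|//|w [_ RA]] := @lindenbaum d A mset0 [mset A].
- by rewrite in_mset0.
- by rewrite in_mset1 => /eqP->; apply: subforms_refl.
have [_ ] := truth w (subforms_refl A); apply; first by apply: RA; rewrite in_mset1.
apply: (@logic_sat d _ _ _ A _ _ logicA w) => [i j u v|i a /Fax_includes].
  exact: wrel_prec.
exact: wrel_axiom.
Qed.
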